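(* Let $\sigma$ be a precomposition on a filtered commutative monoid $(\mathcal S,\oplus)$. For $n\geq1$ let $\mathbb S_n=\{a_s^{(n)}:s\in\mathcal S_n\}$ (distinct symbols indexed by $\mathcal S_n$) and let $\mathbb S=\bigsqcup_{n\geq1}\mathbb S_n$. For $1\leq i\leq n$ define $\circ_i:\mathbb S_n\times\mathbb S_m\to\mathbb S_{n+m-1}$ by $$a_s^{(n)}\circ_ia_{s'}^{(m)}=a^{(n+m-1)}_{\sigma^{i,m}(s)\oplus\sigma^{0,i}(s')}.$$ Then $\mathbb S$ endowed with the partial compositions $\circ_i$ is an operad.
   Context: Operads: a (nonsymmetric, set) operad is a graded set $P=\bigsqcup_{n\geq1}P_n$ with maps $\circ_i:P_n\times P_m\to P_{n+m-1}$ ($1\leq i\leq n$) for which there is a unit $\mathbf 1\in P_1$ such that for $p_1\in P_n,p_2\in P_m,p_3\in P_p$: $(p_1\circ_ip_2)\circ_{j+m-1}p_3=(p_1\circ_jp_3)\circ_ip_2$ for $1\leq i<j\leq n$; $(p_1\circ_ip_2)\circ_{i+j-1}p_3=p_1\circ_i(p_2\circ_jp_3)$ for $1\leq i\leq n$, $1\leq j\leq m$; $p_1\circ_i\mathbf 1=p_1=\mathbf 1\circ_1p_1$. Precompositions: let $\square$ be the monoid with generators $b_{i,n}$ ($i\in\mathbb Z$, $n\geq1$) and relations: $b_{i,n}=b_{0,n}$ for $i<0$; $b_{i,1}=1$ for all $i$; $b_{i,n}b_{j,m}=b_{j+n-1,m}b_{i,n}$ if $i\leq j$ or $i,j\leq0$;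 $b_{i+j,n}b_{i,m}=b_{i,n+m-1}$ if $0\leq j<m$. A filtered commutative monoid is a commutative monoid $(\mathcal S,\oplus)$ with unit $\mathbf 0_{\mathcal S}$ and submonoids $\mathcal S_1\subseteq\mathcal S_2\subseteq\cdots$ with $\mathcal S=\bigcup_n\mathcal S_n$. A precomposition on it is a monoid morphism from $\square$ to the monoid of monoid endomorphisms of $\mathcal S$ (under composition) such that, writing $\sigma^{i,n}$ for the image of $b_{i,n}$: $\sigma^{i,n}(\mathcal S_m)\subseteq\mathcal S_{n+m-1}$, and $\sigma^{i,n}(s)=s$ for $s\in\mathcal S_m$ whenever $i\geq m+1$. *)

(* Defs.v *)
From HB Require Import structures.
From mathcomp Require Import all_boot all_order all_algebra.
From mathcomp Require Import boolp classical_sets.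
From mathcomp Require Import zify.

Set Implicit Arguments.
Unset Strict Implicit.
Unset Printing Implicit Defensive.

Import Order.TTheory GRing.Theory Num.Theory.

Local Open Scope nat_scope.
Local Open Scope quotient_scope.
Local Open Scope classical_set_scope.

Record posnat := PosNat { posnat_val :> nat; posnat_gt0 : 0 < posnat_val }.

HB.instance Definition _ := [isSub for posnat_val].
HB.instance Definition _ := [Countable of posnat by <:].

Definition posnat1 : posnat := @PosNat 1 isT.

Fact graft_subproof (n m : posnat) : 0 < n + m - 1.
Proof. by case: n m => [n n0] [m m0] /=; lia. Qed.

(* Arity of a composite p o_i q with p of arity n and q of arity m. The same
   operation also gives the shifted positions i + j - 1 and j + m - 1. *)
Definition graft (n m : posnat) : posnat := PosNat (graft_subproof n m).

Lemma graft_leq_right (n m j : posnat) : j <= n -> graft j m <= graft n m.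
Proof. by move=> jn /=; lia. Qed.

Lemma graft_leq_left (n m i : posnat) : i <= n -> i <= graft n m.
Proof. by case: m => [m m0] in_ /=; lia. Qed.

Lemma graft_leq (n m i j : posnat) : i <= n -> j <= m -> graft i j <= graft n m.
Proof. by move=> in_ jm /=; lia. Qed.

(* [P n] is the component of arity n of the graded set and [comp n m i] is the
   partial composition o_i : P_n x P_m -> P_(n+m-1) for 1 <= i <= n. The two
   sides of each associativity law lie in components whose indices are equal but
   not convertible, so the laws are stated in the disjoint union
   {n : posnat & P n} of the components. *)
Definition partial_compositions (P : posnat -> Type) :=
  forall n m i : posnat, i <= n -> P n -> P m -> P (graft n m).

Definition in_graded (P : posnat -> Type) (n : posnat) (x : P n) : {n : posnat & P n} :=
  Tagged P x.

Record is_operad (P : posnat -> Type) (comp : partial_compositions P) : Prop := {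
  operad_parallel :
    forall (n m p i j : posnat) (i_n : i <= n) (j_n : j <= n)
           (p1 : P n) (p2 : P m) (p3 : P p),
      i < j ->
      in_graded (comp (graft n m) p (graft j m) (graft_leq_right m j_n)
                   (comp n m i i_n p1 p2) p3)
      = in_graded (comp (graft n p) m i (graft_leq_left p i_n)
                     (comp n p j j_n p1 p3) p2);
  operad_sequential :
    forall (n m p i j : posnat) (i_n : i <= n) (j_m : j <= m)
           (p1 : P n) (p2 : P m) (p3 : P p),
      in_graded (comp (graft n m) p (graft i j) (graft_leq i_n j_m)
                   (comp n m i i_n p1 p2) p3)
      = in_graded (comp n (graft m p) i i_n p1 (comp m p j j_m p2 p3));
  operad_unit :
    exists one : P posnat1,
      (forall (n i : posnat) (i_n : i <= n) (p1 : P n),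
         in_graded (comp n posnat1 i i_n p1 one) = in_graded p1) /\
      (forall (n : posnat) (p1 : P n),
         in_graded (comp posnat1 n posnat1 (leqnn 1) one p1) = in_graded p1)
}.

(* Words in the generators b_(i,n), encoded as pairs (i, n); the presented monoid
   [square] is the quotient of the free monoid on them by the congruence
   generated by [square_rel]. *)
Definition square_word := seq (int * posnat).

Inductive square_rel : square_word -> square_word -> Prop :=
| SquareNeg (i : int) (n : posnat) :
    (i < 0)%R -> square_rel [:: (i, n)] [:: (0%R, n)]
| SquareOne (i : int) : square_rel [:: (i, posnat1)] [::]
| SquareSwap (i j : int) (n m : posnat) :
    (i <= j)%R \/ ((i <= 0)%R /\ (j <= 0)%R) ->
    square_rel [:: (i, n); (j, m)] [:: ((j + n%:Z - 1)%R, m); (i, n)]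
| SquareMerge (i j : int) (n m : posnat) :
    (0 <= j < m%:Z)%R ->
    square_rel [:: ((i + j)%R, n); (i, m)] [:: (i, graft n m)].

Inductive square_cong : square_word -> square_word -> Prop :=
| square_cong_base u v : square_rel u v -> square_cong u v
| square_cong_refl u : square_cong u u
| square_cong_sym u v : square_cong u v -> square_cong v u
| square_cong_trans u v w :
    square_cong u v -> square_cong v w -> square_cong u w
| square_cong_cat u u' v v' :
    square_cong u u' -> square_cong v v' -> square_cong (u ++ v) (u' ++ v').

Definition square_congb (u v : square_word) : bool := `[< square_cong u v >].

Fact square_congb_refl : reflexive square_congb.
Proof. by move=> u; apply/asboolP; apply: square_cong_refl. Qed.

Fact square_congb_sym : symmetric square_congb.
Proof.
by move=> u v; apply/asboolP/asboolP => uv; apply: square_cong_sym.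
Qed.

Fact square_congb_trans : transitive square_congb.
Proof.
move=> v u w /asboolP uv /asboolP vw; apply/asboolP.
exact: square_cong_trans uv vw.
Qed.

Canonical square_equiv :=
  EquivRel square_congb square_congb_refl square_congb_sym square_congb_trans.

Definition square := {eq_quot square_equiv}.
HB.instance Definition _ := Choice.on square.
HB.instance Definition _ := EqQuotient.on square.

Definition square_of_word (w : square_word) : square := \pi_square w.

Lemma square_of_wordP (u v : square_word) :
  square_of_word u = square_of_word v <-> square_cong u v.
Proof.
split=> [/eqP|uv]; last by apply/eqP; rewrite eqmodE; apply/asboolP.
by rewrite /square_of_word eqmodE => /asboolP.
Qed.

Definition square_one : square := square_of_word [::].
Definition square_mul (x y : square) : square :=
  square_of_word (repr x ++ repr y).

Lemma square_mul_word (u v : square_word) :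
  square_mul (square_of_word u) (square_of_word v) = square_of_word (u ++ v).
Proof.
by apply/square_of_wordP; apply: square_cong_cat; apply/square_of_wordP;
  rewrite /square_of_word reprK.
Qed.

Lemma square_of_word_surj (x : square) : exists w, x = square_of_word w.
Proof. by exists (repr x); rewrite /square_of_word reprK. Qed.

Fact square_mulA : associative square_mul.
Proof.
move=> x y z; have [u ->] := square_of_word_surj x.
have [v ->] := square_of_word_surj y; have [w ->] := square_of_word_surj z.
by rewrite !square_mul_word catA.
Qed.

Fact square_mul1x : left_id square_one square_mul.
Proof.
by move=> x; have [u ->] := square_of_word_surj x; rewrite square_mul_word.
Qed.

Fact square_mulx1 : right_id square_one square_mul.
Proof.
move=> x; have [u ->] := square_of_word_surj x.
by rewrite square_mul_word cats0.
Qed.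

HB.instance Definition _ :=
  isMonoid.Build square square_mulA square_mul1x square_mulx1.

Definition square_gen (i : int) (n : posnat) : square := square_of_word [:: (i, n)].

(* The product of this monoid is composition, [f * g] being [f \o g]. *)
Definition cmon_end (S : nmodType) : Type := {additive S -> S}.

Section CMonEnd.
Variable S : nmodType.

HB.instance Definition _ := gen_eqMixin (cmon_end S).
HB.instance Definition _ := gen_choiceMixin (cmon_end S).

Definition cmon_end_one : cmon_end S := idfun.
Definition cmon_end_mul (f g : cmon_end S) : cmon_end S :=
  (f : {additive S -> S}) \o (g : {additive S -> S}).

Lemma cmon_end_ext (f g : cmon_end S) :
  (f : {additive S -> S}) =1 (g : {additive S -> S}) -> f = g.
Proof.
case: f g => [f [[f0]]] [g [[g0]]] /= /funext fg.
by case: _ / fg g0 => g0; rewrite (Prop_irrelevance f0 g0).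
Qed.

Fact cmon_end_mulA : associative cmon_end_mul.
Proof. by move=> f g h; apply: cmon_end_ext. Qed.

Fact cmon_end_mul1x : left_id cmon_end_one cmon_end_mul.
Proof. by move=> f; apply: cmon_end_ext. Qed.

Fact cmon_end_mulx1 : right_id cmon_end_one cmon_end_mul.
Proof. by move=> f; apply: cmon_end_ext. Qed.

HB.instance Definition _ :=
  isMonoid.Build (cmon_end S) cmon_end_mulA cmon_end_mul1x cmon_end_mulx1.

End CMonEnd.

Record filtered_cmonoid := FilteredCMonoid {
  fcm_sort :> nmodType;
  layer : posnat -> set fcm_sort;
  layer0 : forall n, layer n 0%R;
  layerD : forall n s t, layer n s -> layer n t -> layer n (s + t)%R;
  layer_mono : forall n m : posnat, n <= m -> layer n `<=` layer m;
  layer_cover : \bigcup_(n : posnat) layer n = setT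
}.

Arguments layer : clear implicits.

Record precomposition (S : filtered_cmonoid) := Precomposition {
  precomp_morph : UMagmaMorphism.type square (cmon_end S);
  precomp_layer : forall (i : int) (n m : posnat) (s : S),
    layer S m s ->
    layer S (graft n m) ((precomp_morph (square_gen i n) : {additive S -> S}) s);
  precomp_above : forall (i : int) (n m : posnat) (s : S),
    layer S m s -> (m%:Z + 1 <= i)%R ->
    (precomp_morph (square_gen i n) : {additive S -> S}) s = s
}.

Definition sigma_op (S : filtered_cmonoid) (sigma : precomposition S)
  (i : int) (n : posnat) : {additive S -> S} := precomp_morph sigma (square_gen i n).

(* [Symb s : symb S n] is the symbol a_s^(n). *)
Inductive symb (S : filtered_cmonoid) (n : posnat) : Type :=
  Symb of layer S n.

Definition symb_label (S : filtered_cmonoid) (n : posnat) (a : symb S n) :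
  layer S n := let: Symb s := a in s.

Section SymbComp.
Variables (S : filtered_cmonoid) (sigma : precomposition S).

Lemma symb_comp_layer (n m i : posnat) (s s' : S) :
  i <= n -> layer S n s -> layer S m s' ->
  layer S (graft n m) (sigma_op sigma i%:Z m s + sigma_op sigma 0%R i s')%R.
Proof.
move=> i_n sn s'm; apply: layerD.
  by apply: layer_mono (precomp_layer sigma i%:Z m sn) => /=; lia.
by apply: layer_mono (precomp_layer sigma 0%R i s'm) => /=; lia.
Qed.

Definition symb_comp : partial_compositions (symb S) :=
  fun n m i i_n a a' =>
    let s := symb_label a in let s' := symb_label a' in
    Symb (SigSub (mem_set (symb_comp_layer i_n (set_valP s) (set_valP s')))).

End SymbComp.

(* Main.v *)
(* Label by label, each operad law is one identity per input symbol. In the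
   parallel and sequential laws, the label of p1 is treated by
   [b_(i,n) b_(j,m) = b_(j+n-1,m) b_(i,n)] and by
   [b_(i+j,n) b_(i,m) = b_(i,n+m-1)] respectively, the label of p3 always by the
   latter relation at [i = 0], and the label of p2 in the sequential law by the
   former at [i = 0]. In the parallel law [sigma^(j+m-1,p)] must fix
   [sigma^(0,i) s2]; this holds because [i < j] puts the position above the layer
   [m + i - 1] of that label. The unit is the symbol of [0] in arity 1. *)
From mathcomp Require Import all_boot all_algebra.
From mathcomp Require Import classical_sets zify.
Require Import Defs.

Set Implicit Arguments.
Unset Strict Implicit.
Unset Printing Implicit Defensive.

Import GRing.Theory.

Local Open Scope ring_scope.

Lemma graftC (n m : posnat) : graft n m = graft m n.
Proof. by apply/val_inj; rewrite /= addnC. Qed.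

(** Arities being positive, the truncated subtraction in [graft] agrees with the integer one. *)
Lemma graftZ (n m : posnat) : (graft n m)%:Z = n%:Z + m%:Z - 1.
Proof. by case: n m => [n n0] [m m0] /=; lia. Qed.

Lemma graftAC (n m p : posnat) : graft (graft n m) p = graft (graft n p) m.
Proof. by apply/val_inj => /=; case: m p => [m m0] [p p0] /=; lia. Qed.

Lemma graftA (n m p : posnat) : graft (graft n m) p = graft n (graft m p).
Proof. by apply/val_inj => /=; case: m p => [m m0] [p p0] /=; lia. Qed.

Lemma graft1n (n : posnat) : graft posnat1 n = n.
Proof. by apply/val_inj; rewrite /= addnC addnK. Qed.

Lemma graftn1 (n : posnat) : graft n posnat1 = n.
Proof. by rewrite graftC graft1n. Qed.

Section SymbolOperad.
Variables (S : filtered_cmonoid) (sigma : precomposition S).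

(** Membership proofs are irrelevant, so each operad law splits into an identity of arities and an
    equation in [S]. *)
Lemma in_graded_symb_eq (n m : posnat) (a : symb S n) (b : symb S m) :
  n = m -> val (symb_label a) = val (symb_label b) ->
  in_graded a = in_graded b.
Proof.
move=> nm; case: _ / nm b => -[b].
by case: a => a /= /val_inj ->.
Qed.

Lemma symb_compE (n m i : posnat) (i_n : (i <= n)%N) (a : symb S n)
    (b : symb S m) :
  val (symb_label (symb_comp sigma i_n a b))
  = sigma_op sigma i%:Z m (val (symb_label a))
    + sigma_op sigma 0 i (val (symb_label b)).
Proof. by []. Qed.

Lemma sigma_op1 (i : int) : sigma_op sigma i posnat1 =1 id.
Proof.
move=> s; rewrite /sigma_op.
have -> : square_gen i posnat1 = 1%g.
  exact/square_of_wordP/square_cong_base/SquareOne.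
by rewrite gmulf1.
Qed.

Lemma sigma_op_comp (i j : int) (n m : posnat) (s : S) :
  sigma_op sigma i n (sigma_op sigma j m s)
  = (precomp_morph sigma (square_of_word [:: (i, n); (j, m)])
      : {additive S -> S}) s.
Proof.
by rewrite -[[:: _; _]]/([:: (i, n)] ++ [:: (j, m)]) -square_mul_word gmulfM.
Qed.

Lemma sigma_op_swap (i j : int) (n m : posnat) (s : S) :
  i <= j ->
  sigma_op sigma (j + n%:Z - 1) m (sigma_op sigma i n s)
  = sigma_op sigma i n (sigma_op sigma j m s).
Proof.
move=> ij; rewrite !sigma_op_comp.
congr ((precomp_morph sigma _ : {additive _ -> _}) _).
by apply/esym/square_of_wordP/square_cong_base/SquareSwap; left.
Qed.

Lemma sigma_op_merge (i k : int) (n m : posnat) (s : S) :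
  i <= k < i + m%:Z ->
  sigma_op sigma k n (sigma_op sigma i m s) = sigma_op sigma i (graft n m) s.
Proof.
move=> km; rewrite -{1}(subrKC i k) sigma_op_comp.
congr ((precomp_morph sigma _ : {additive _ -> _}) _).
by apply/square_of_wordP/square_cong_base/SquareMerge; lia.
Qed.

(** The inner image lies in layer [m + p - 1], and positions from [m + p] on act trivially there. *)
Lemma sigma_op_above (i k : int) (n m p : posnat) (a : symb S m) :
  m%:Z + p%:Z <= k ->
  sigma_op sigma k n (sigma_op sigma i p (val (symb_label a)))
  = sigma_op sigma i p (val (symb_label a)).
Proof.
move=> mpk; apply: precomp_above (precomp_layer sigma i p _) _.
  exact: set_valP.
by rewrite graftZ; lia.
Qed.

End SymbolOperad.

Theorem proposition4 (S : filtered_cmonoid) (sigma : precomposition S) :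
  is_operad (symb_comp sigma).
Proof.
split.
- move=> n m p i j i_n j_n a b c ij.
  apply: in_graded_symb_eq; first exact: graftAC.
  rewrite !symb_compE !raddfD graftZ sigma_op_swap; last by lia.
  (* By [i < j], position [i] is among the positions [0, ..., j - 1] where merging is allowed. *)
  rewrite (@sigma_op_merge _ _ 0 i); last by lia.
  rewrite (@sigma_op_above _ _ 0); last by lia.
  by rewrite (graftC m) addrAC.
- move=> n m p i j i_n j_m a b c.
  apply: in_graded_symb_eq; first exact: graftA.
  have i0 := posnat_gt0 i; have j0 := posnat_gt0 j.
  rewrite !symb_compE !raddfD graftZ.
  rewrite sigma_op_merge; last by lia.
  (* Read as [j + i - 1], the outer position is [j] shifted past an operator of arity [i] at
     position [0]. *)
  rewrite (graftC p) (addrC i%:Z) sigma_op_swap //.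
  rewrite (@sigma_op_merge _ _ 0 0); last by lia.
  by rewrite addrA.
(* Additive maps kill [0], so only [sigma_op] of arity 1, the identity, acts on the other label. *)
- exists (Symb (SigSub (mem_set (layer0 S posnat1)))); split=> [n i i_n a|n a].
    apply: in_graded_symb_eq; first exact: graftn1.
    by rewrite symb_compE raddf0 addr0 sigma_op1.
  apply: in_graded_symb_eq; first exact: graft1n.
  by rewrite symb_compE raddf0 add0r sigma_op1.
Qed.
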